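(* Let $k\ge1$. The graph $kC_3$ (the disjoint union of $k$ triangles) is $k$-super graceful if and only if $k=1$.
   Context: For integers $a\le b$, $[a,b]$ is the set of integers between $a$ and $b$ inclusive. For $k\ge 1$, a $k$-super graceful labeling of a graph $G=(V,E)$ with $p$ vertices and $q$ edges is a bijection $f:V\cup E\to[k,k+p+q-1]$ with $f(uv)=|f(u)-f(v)|$ for every edge $uv$; $G$ is $k$-super graceful if it admits one. *)

(* Defs.v *)
From HB Require Import structures.
From mathcomp Require Import all_boot all_order all_algebra.

Set Implicit Arguments.
Unset Strict Implicit.
Unset Printing Implicit Defensive.

Record sgraph := SGraph {
  vertex :> finType;
  adj : rel vertex;
  adj_sym : symmetric adj;
  adj_irr : irreflexive adj }.

Definition edges (G : sgraph) : {set {set G}} :=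
  [set [set x; y] | x in [set: G], y in [set: G] & adj x y].

Definition edge (G : sgraph) : finType := {e : {set G} | e \in edges G}.

Lemma adj_edges (G : sgraph) (u v : G) : adj u v -> [set u; v] \in edges G.
Proof. by move=> uv; apply/imset2P; exists u v; rewrite ?inE. Qed.

Definition edge_of (G : sgraph) (u v : G) (uv : adj u v) : edge G :=
  exist _ [set u; v] (adj_edges uv).

Definition segment (a b : nat) : Type := {n : nat | a <= n <= b}.

(* For k >= 1 the truncated subtraction below is exact; the bars denote the
   distance between natural numbers, not truncated subtraction. *)
Definition super_graceful_labeling (k : nat) (G : sgraph)
    (f : G + edge G -> segment k (k + #|G| + #|edge G| - 1)) : Prop :=
  bijective f /\
  forall (u v : G) (uv : adj u v),
    val (f (inr (edge_of uv))) = `|val (f (inl u)) - val (f (inl v))|%N.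

Definition super_graceful (k : nat) (G : sgraph) : Prop :=
  exists f : G + edge G -> segment k (k + #|G| + #|edge G| - 1),
    super_graceful_labeling f.

(* The cycle C_n for n >= 3; the first conjunct only matters for n = 1. *)
Definition cycle_adj (n : nat) : rel 'I_n :=
  fun i j => (i != j) && ((j == i.+1 %% n :> nat) || (i == j.+1 %% n :> nat)).

Lemma cycle_adj_sym n : symmetric (@cycle_adj n).
Proof. by move=> i j; rewrite /cycle_adj eq_sym orbC. Qed.

Lemma cycle_adj_irr n : irreflexive (@cycle_adj n).
Proof. by move=> i; rewrite /cycle_adj eqxx. Qed.

Definition cycle_graph (n : nat) : sgraph :=
  SGraph (@cycle_adj_sym n) (@cycle_adj_irr n).

Definition copies_adj (k : nat) (G : sgraph) : rel ('I_k * G)%type :=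
  fun x y => (x.1 == y.1) && adj x.2 y.2.

Lemma copies_adj_sym k G : symmetric (@copies_adj k G).
Proof. by move=> x y; rewrite /copies_adj eq_sym adj_sym. Qed.

Lemma copies_adj_irr k G : irreflexive (@copies_adj k G).
Proof. by move=> x; rewrite /copies_adj adj_irr andbF. Qed.

Definition copies (k : nat) (G : sgraph) : sgraph :=
  SGraph (@copies_adj_sym k G) (@copies_adj_irr k G).

(* Main.v *)
Require Import Defs.
From mathcomp Require Import all_boot all_order all_algebra.
From mathcomp Require Import zify.

(** Order the vertex labels of each triangle as [a < a + x < a + x + y = c], so
    that its six labels are [a], [x], [y], [a + x], [x + y] and [c], with sum
    [3 c + x]. All labels together are the integers from [k] to [7 k - 1], of
    sum [24 k^2 - 3 k]. The [k] labels [c] are at most the [k] largest ones,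
    hence the sum of the labels [x] is at least [(9 k^2 - 3 k) / 2]. The [2 k]
    labels [a] and [y] are at least the [2 k] smallest ones, so that
    [x = c - a - y] makes that sum at most [(5 k^2 + k) / 2]. Therefore
    [k <= 1]. *)

(** The entry at position [i], counted from 0, is at least [m + i]; the left-hand side adds up these
    bounds. In the induction, [x.+1] bounds the tail from below. *)
Lemma leq_sum_sorted_ltn (s : seq nat) (m : nat) :
  sorted ltn s -> all (leq m) s ->
  m * size s + 'C(size s, 2) <= \sum_(x <- s) x.
Proof.
elim: s m => [|x s IHs] m /=; first by rewrite big_nil muln0.
rewrite (path_sortedE ltn_trans) big_cons => /andP[x_lt s_sorted] /andP[mx _].
have := IHs x.+1 s_sorted x_lt; rewrite binS bin1.
have : m * (size s).+1 <= x * (size s).+1 by rewrite leq_mul2r mx orbT.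
by rewrite mulnS mulSn; lia.
Qed.

Lemma leq_sum_inj {I : finType} (g : I -> nat) (m : nat) :
  injective g -> (forall i, m <= g i) -> m * #|I| + 'C(#|I|, 2) <= \sum_i g i.
Proof.
move=> g_inj g_ge; pose s := sort leq [seq g i | i <- enum I].
have s_perm : perm_eq s [seq g i | i <- enum I] by rewrite perm_sort.
have -> : \sum_i g i = \sum_(x <- s) x.
  by rewrite (perm_big _ s_perm) big_map big_enum.
have -> : #|I| = size s by rewrite size_sort size_map -cardE.
apply: leq_sum_sorted_ltn.
  rewrite ltn_sorted_uniq_leq (perm_uniq s_perm) map_inj_uniq // enum_uniq.
  exact/sort_sorted/leq_total.
by rewrite (perm_all _ s_perm); apply/allP=> _ /mapP[i _ ->].
Qed.

Lemma sum_inj_leq {I : finType} (g : I -> nat) (m : nat) :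
  injective g -> (forall i, g i <= m) ->
  \sum_i g i + 'C(#|I|, 2) <= m * #|I|.
Proof.
move=> g_inj g_le.
(* The reflection [m - g i], exact since [g i <= m], turns the claim into the lower bound with 0 for
   [m]. *)
have h_inj : injective (fun i => m - g i).
  by move=> i j; move: (g_le i) (g_le j) => gi gj gij; apply: g_inj; lia.
have := leq_sum_inj (fun i => m - g i) 0 h_inj (fun=> leq0n _).
suff : \sum_i (m - g i) + \sum_i g i = m * #|I| by lia.
rewrite -big_split /= (eq_bigr (fun=> m)) ?sum_nat_const 1?[RHS]mulnC //.
by move=> i _; rewrite subnK.
Qed.

Notation C3 := (cycle_graph 3).

Lemma adj_copies_C3 k (x y : copies k C3) :
  adj x y = (x.1 == y.1) && (x.2 != y.2).
Proof.
case: x y => [i u] [j v] /=; rewrite /copies_adj /= /cycle_adj.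
by congr (_ && _); case: u v => [[|[|[]]]] // ? [[|[|[]]]].
Qed.

Lemma adj_ordS k (x : 'I_k * 'I_3) :
  adj (x : copies k C3) (x.1, ordS x.2).
Proof. by rewrite adj_copies_C3 eqxx; case: x => i [[|[|[]]]]. Qed.

(** With each triangle oriented cyclically, an edge is indexed by its initial vertex. *)
Definition C3_edge k (x : 'I_k * 'I_3) : edge (copies k C3) :=
  edge_of (adj_ordS k x).

(** [ordS (ordS x.2)] is the vertex opposite to the edge; together with the triangle it determines
    the edge, whence injectivity below. *)
Lemma mem_C3_edge k (x y : 'I_k * 'I_3) :
  (y \in val (C3_edge k x)) = (y.1 == x.1) && (y.2 != ordS (ordS x.2)).
Proof.
case: x y => [i u] [j v]; rewrite !inE !xpair_eqE /= -andb_orr.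
by congr (_ && _); case: u v => [[|[|[]]]] // ? [[|[|[]]]].
Qed.

Lemma C3_edge_inj k : injective (C3_edge k).
Proof.
move=> [i u] [j v] euv.
have mem_uv y := congr1 (fun e : edge _ => y \in val e) euv.
have u_edge : u != ordS (ordS u) by case: u {euv mem_uv} => [[|[|[]]]].
have := mem_uv (i, u); rewrite !mem_C3_edge /= eqxx u_edge.
move=> /esym/andP[/eqP ij _]; rewrite -ij in mem_uv *.
congr (_, _).
have := mem_uv (i, ordS (ordS u)); rewrite !mem_C3_edge /= !eqxx /=.
by case: eqP => // uv _; do 2!apply: (can_inj (@ordSK 3)).
Qed.

(** Of two vertices of a triangle, one follows the other cyclically; the [if] selects the initial
    one. *)
Lemma edge_of_C3_edge k (x y : copies k C3) (xy : adj x y) :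
  edge_of xy = C3_edge k (if y.2 == ordS x.2 then x else y).
Proof.
case: x y xy => [i u] [j v] xy.
have := xy; rewrite [X in is_true X -> _]adj_copies_C3 => /andP[/= /eqP ij uv].
rewrite -{j}ij in xy *.
apply/val_inj/setP=> -[l w]; rewrite mem_C3_edge !inE !xpair_eqE {xy}.
rewrite -andb_orr [LHS]andbC [RHS]andbC.
case: ifP; (case: (l == i); rewrite ?andbF //= !andbT);
  by case: u v w uv => [[|[|[]]]] // ? [[|[|[]]]] // ? [[|[|[]]]].
Qed.

Lemma C3_edge_bij k : bijective (C3_edge k).
Proof.
have C3_edge_surj e : exists x, C3_edge k x == e.
  case: e => A A_edge; have /imset2P[x y _] := A_edge.
  rewrite !inE => xy defA; move: A_edge; rewrite defA => A_edge.
  exists (if y.2 == ordS x.2 then x else y).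
  by rewrite -(edge_of_C3_edge k x y xy); apply/eqP/val_inj.
exists (fun e => xchoose (C3_edge_surj e)) => [x|e].
  exact/C3_edge_inj/eqP/(xchooseP (C3_edge_surj _)).
exact/eqP/(xchooseP (C3_edge_surj _)).
Qed.

Lemma card_copies_C3 k : #|copies k C3| = 3 * k.
Proof. by rewrite card_prod !card_ord mulnC. Qed.

Lemma card_edge_copies_C3 k : #|edge (copies k C3)| = 3 * k.
Proof. by rewrite -(bij_eq_card (C3_edge_bij k)) card_prod !card_ord mulnC. Qed.

(* [L (j, false)] is the label of vertex [j] of a triangle, and [L (j, true)]
   that of the edge from [j] to [ordS j]. *)
Lemma triangle_labels (L : 'I_3 * bool -> nat) :
  (forall j, L (j, true) = `|L (j, false) - L (ordS j, false)|%N) ->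
  exists t : ('I_3 * bool) * ('I_3 * bool) * (bool -> 'I_3 * bool),
    [/\ injective t.2, L t.1.1 = L (t.2 false) + L t.1.2 + L (t.2 true)
      & \sum_j L j = 3 * L t.1.1 + L t.1.2].
Proof.
move=> edgeL; pose o0 : 'I_3 := ord0; pose o1 := ordS o0; pose o2 := ordS o1.
have o3 : ordS o2 = o0 by apply: val_inj.
have sumL :
    \sum_j L j = \sum_(j <- [:: o0; o1; o2]) (L (j, true) + L (j, false)).
  transitivity (\sum_(j < 3) \sum_(b : bool) L (j, b)).
    by rewrite pair_big; apply: eq_bigr => -[].
  rewrite !big_ord_recl big_ord0 !big_cons big_nil !big_bool.
  by do !congr (_ + _); congr (L (_, _)); apply: val_inj.
have [E0 [E1 E2]] := (edgeL o0, (edgeL o1, edgeL o2)); rewrite o3 in E2.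
(* Here [x] indexes the edge between [a] and [b], and [y] the edge between [b] and [c]. *)
have sorted_case (c b a x y : 'I_3) :
    L (a, false) <= L (b, false) <= L (c, false) ->
    L (x, true) = L (b, false) - L (a, false) ->
    L (y, true) = L (c, false) - L (b, false) ->
    \sum_j L j = 3 * L (c, false) + L (x, true) ->
  exists t : ('I_3 * bool) * ('I_3 * bool) * (bool -> 'I_3 * bool),
    [/\ injective t.2, L t.1.1 = L (t.2 false) + L t.1.2 + L (t.2 true)
      & \sum_j L j = 3 * L t.1.1 + L t.1.2].
  move=> abc Lx Ly sumE.
  exists ((c, false), (x, true), fun s => if s then (y, true) else (a, false)).
  by split=> //= [[] []|] //; lia.
rewrite !big_cons big_nil in sumL; rewrite -/o1 -/o2 in E0 E1.
(* Of the eight outcomes, two are cyclic, hence contradictory; the others are the six orders of the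
   vertices. *)
have [p01|p10] := leqP (L (o0, false)) (L (o1, false));
have [p12|p21] := leqP (L (o1, false)) (L (o2, false));
have [p02|p20] := leqP (L (o0, false)) (L (o2, false)); try lia.
- apply: (sorted_case o2 o1 o0 o0 o1); lia.
- apply: (sorted_case o1 o2 o0 o2 o1); lia.
- apply: (sorted_case o1 o0 o2 o2 o0); lia.
- apply: (sorted_case o2 o0 o1 o0 o2); lia.
- apply: (sorted_case o0 o2 o1 o1 o2); lia.
- apply: (sorted_case o0 o1 o2 o1 o0); lia.
Qed.

Lemma triangle_labelings_leq1 k (L : 'I_k * ('I_3 * bool) -> nat) :
  injective L -> (forall x, k <= L x <= (7 * k).-1) ->
  (forall i j, L (i, (j, true)) =
     `|L (i, (j, false)) - L (i, (ordS j, false))|%N) ->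
  k <= 1.
Proof.
move=> L_inj L_bound edgeL.
have /fin_all_exists[t tP] i := triangle_labels (fun j => L (i, j)) (edgeL i).
pose c i := L (i, (t i).1.1).
(* The labels [a] (at [false]) and [y] (at [true]) form one injective family of size [2 k]. *)
pose ay (x : 'I_k * bool) := L (x.1, (t x.1).2 x.2).
have c_le : \sum_i c i + 'C(k, 2) <= (7 * k).-1 * k.
  have := sum_inj_leq c (7 * k).-1; rewrite card_ord; apply.
    by move=> i i' /L_inj[].
  by move=> i; case/andP: (L_bound (i, (t i).1.1)).
have ay_ge : k * (k * 2) + 'C(k * 2, 2) <= \sum_x ay x.
  have := leq_sum_inj ay k; rewrite card_prod card_ord card_bool; apply.
    move=> [i s] [i' s'] /L_inj[<- tss']; congr (_, _).
    by have [t_inj _ _] := tP i; apply: t_inj.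
  by move=> x; case/andP: (L_bound (x.1, (t x.1).2 x.2)).
have L_ge : k * (k * 6) + 'C(k * 6, 2) <= \sum_x L x.
  have := leq_sum_inj L k; rewrite !card_prod !card_ord card_bool; apply=> // x.
  by case/andP: (L_bound x).
have cE : \sum_i c i = \sum_x ay x + \sum_i L (i, (t i).1.2).
  transitivity (\sum_i (\sum_s ay (i, s) + L (i, (t i).1.2))).
    apply: eq_bigr => i _; rewrite big_bool /ay /c /=.
    by have [_ -> _] := tP i; lia.
  by rewrite big_split pair_big; congr (_ + _); apply: eq_bigr => -[].
have LE : \sum_x L x = 3 * \sum_i c i + \sum_i L (i, (t i).1.2).
  transitivity (\sum_i \sum_j L (i, j)).
    by rewrite pair_big; apply: eq_bigr => -[].
  rewrite big_distrr -big_split; apply: eq_bigr => i _.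
  by have [_ _ ->] := tP i.
(* Removing the binomials leaves [k * k] as the only nonlinear term for [lia]. *)
have bin2D n : 2 * 'C(n, 2) + n = n * n.
  by rewrite -mul_bin_diag bin1; case: n => // n; rewrite -mulnSr.
have [B1 [B2 B6]] := (bin2D k, (bin2D (k * 2), bin2D (k * 6))).
rewrite [in RHS]mulnACA in B2; rewrite [in RHS]mulnACA in B6.
rewrite !mulnA in ay_ge L_ge.
have [k0|k_gt0] := posnP k; first by rewrite k0.
have M7 : (7 * k).-1 * k + k = 7 * (k * k).
  by rewrite -mulSnr prednK ?muln_gt0 // mulnA.
(* Four times the sum of [c] minus the sum of [ay] is the total, so [24 k^2 - 3 k <= (26 k^2 - 2 k)
   - (4 k^2 - k)]. *)
have : k * k <= k * 1 by lia.
by rewrite leq_pmul2l.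
Qed.

Theorem theorem3p23 (k : nat) (hk : 1 <= k) :
  super_graceful k (copies k (cycle_graph 3)) <-> k = 1.
Proof.
split=> [[f [f_bij edge_f]]|{hk}->].
  pose el (x : 'I_k * ('I_3 * bool)) : copies k C3 + edge (copies k C3) :=
    if x.2.2 then inr (C3_edge k (x.1, x.2.1)) else inl (x.1, x.2.1).
  apply/eqP; rewrite eqn_leq hk andbT.
  apply: (triangle_labelings_leq1 k (fun x => val (f (el x)))).
  - move=> [i [j s]] [i' [j' s']] /val_inj/(bij_inj f_bij).
    rewrite /el /=; case: s s' => [] [] //.
      by move=> lab_eq; have [-> ->] := C3_edge_inj k _ _ (inr_inj lab_eq).
    by case=> -> ->.
  - move=> x; case: (f (el x)) => n /=.
    rewrite card_copies_C3 card_edge_copies_C3; lia.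
  - by move=> i j; apply: edge_f.
have [h hK Kh] := C3_edge_bij 1.
(* Vertices 1, 4, 6 give the edges, in cyclic order, the differences 3, 2, 5. *)
pose vlab (x : 'I_1 * 'I_3) := nth 0 [:: 1; 4; 6] x.2.
pose elab (x : 'I_1 * 'I_3) := nth 0 [:: 3; 2; 5] x.2.
pose lab (z : copies 1 C3 + edge (copies 1 C3)) :=
  match z with inl x => vlab x | inr e => elab (h e) end.
have lab_bound z :
    1 <= lab z <= 1 + #|copies 1 C3| + #|edge (copies 1 C3)| - 1.
  rewrite card_copies_C3 card_edge_copies_C3 /lab /vlab /elab.
  by case: z => [[i [[|[|[]]]]]|e] //; case: (h e) => i [[|[|[]]]].
exists (fun z => exist _ (lab z) (lab_bound z)); split; last first.
  move=> u v uv; rewrite /= edge_of_C3_edge hK /elab /vlab.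
  move: uv; rewrite adj_copies_C3; case: u v => [i u] [j v] /andP[_ /=].
  by case: u v => [[|[|[]]]] // ? [[|[|[]]]].
pose V j : copies 1 C3 + edge (copies 1 C3) := inl (ord0, inord j).
pose E j : copies 1 C3 + edge (copies 1 C3) := inr (C3_edge 1 (ord0, inord j)).
(* The inverse table, listed by labels 1 to 6; hence the shift [n.-1]. *)
pose unlab n := nth (V 0) [:: V 0; E 1; E 0; V 1; E 2; V 2] n.-1.
exists (fun s => unlab (val s)) => [[[i j]|e]|[n n_bound]].
- rewrite [i]ord1; case: j => [[|[|[]]]] // j3; congr (inl (_, _));
    by apply: val_inj; rewrite /= inordK.
- rewrite /= -{2}(Kh e); case: (h e) => i j.
  rewrite [i]ord1; case: j => [[|[|[]]]] // j3; congr (inr (C3_edge _ (_, _)));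
    by apply: val_inj; rewrite /= inordK.
apply: val_inj => /=; move: (n_bound).
rewrite card_copies_C3 card_edge_copies_C3.
by case: n {n_bound} => [|[|[|[|[|[|[]]]]]]] //= _;
  rewrite ?hK /vlab /elab /= inordK.
Qed.
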